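(* Let $q>3$ be a prime power, and suppose there exists a primitive element $\phi$ of the finite field $\mathbb{F}_q$ for which both $1-\phi$ and $1-\phi^{-1}$ are also primitive. Then: (i) the $(q-3)\times(q-3)\times(q-3)$ array $D=(d_{i,j,k})$ with entries in $\{0,1\}$ given, for $i,j,k\in\{1,2,\dots,q-3\}$, by $$d_{i,j,k} = I\big[\phi^{i+1}+(1-\phi)^{j+1}=1 \ \text{ and }\ \phi^{-(i+1)}+(1-\phi^{-1})^{k+1}=1 \ \text{ and }\ (1-\phi)^{-(j+1)}+(1-\phi^{-1})^{-(k+1)}=1\big]$$ is an order $q-3$ Costas cube for which Projection $A$ is the $G_3(q,\phi)$ Golomb Costas array, Projection $B$ is the $G_3(q,\phi^{-1})$ Golomb Costas array, and Projection $C$ is the $G_3(q,(1-\phi)^{-1})$ Golomb Costas array; (ii) the $(q-3)\times(q-3)\times(q-3)$ array $E=(e_{i,j,k})$ with entries in $\{0,1\}$ given, for $i,j,k\in\{1,2,\dots,q-3\}$, by $$e_{i,j,k} = I\big[\phi^{i+1}+(1-\phi)^{j+1}=1 \ \text{ and }\ \phi^{i}+(1-\phi^{-1})^{k+1}=1 \ \text{ and }\ (1-\phi)^{j}+(1-\phi^{-1})^{k}=1\big]$$ is an order $q-3$ Costas cube for which Projection $A$ is the $G_3(q,\phi)$ Golomb Costas array, Projection $B$ is the reflection through a vertical axis of the $G_3(q,\phi^{-1})$ Golomb Costas array, and Projection $C$ is the rotation through $180^\circ$ of the $G_3(q,(1-\phi)^{-1})$ Golomb Costas array.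
   Context: $I[X]$ denotes the indicator of condition $X$ ($1$ if $X$ is true, $0$ otherwise). A primitive element of $\mathbb{F}_q$ is a generator of the multiplicative group $\mathbb{F}_q^*$. The equations inside the indicator functions are equations in $\mathbb{F}_q$. An order $n$ permutation array is an $n\times n$ array $(s_{i,j})$, with $i,j\in\{1,\dots,n\}$, of the form $s_{i,j} = I[\sigma(j)=i]$ for a permutation $\sigma$ of $\{1,\dots,n\}$. It is an order $n$ Costas array if the vectors joining pairs of $1$ entries are all distinct: whenever $(P,Q)$ and $(P',Q')$ are different ordered pairs of distinct positions, all containing $1$ entries, then $Q-P \ne Q'-P'$ in $\mathbb{Z}^2$. The projections of a three-dimensional array $(d_{i,j,k})$ are Projection $A = (a_{i,j}) = (\sum_k d_{i,j,k})$, Projection $B = (b_{i,k}) = (\sum_j d_{i,j,k})$, and Projection $C = (c_{j,k}) = (\sum_i d_{i,j,k})$. An order $n$ Costas cube is an $n\times n\times n$ array with entries in $\{0,1\}$ (an ''array over $\mathbb{Z}_2$'') for which Projections $A$, $B$, $C$ are each order $n$ Costas arrays. For $\alpha$ a primitive element of $\mathbb{F}_q$ such that $1-\alpha$ is also primitive, the $G_3(q,\alpha)$ Golomb Costas array is the $(q-3)\times(q-3)$ array $(s_{i,j})$ given by $s_{i,j} = I[\alpha^{i+1}+(1-\alpha)^{j+1}=1]$ for $i,j\in\{1,\dots,q-3\}$ (classically known to be an order $q-3$ Costas array for $q>3$). Arrays are drawn with the first index increasing from left to right and the second from bottom to top. So for an $n\times n$ array $(s_{u,v})$, its reflection through a vertical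 axis is the array $(r_{u,v})$ with $r_{u,v}=s_{n+1-u,v}$, and its rotation through $180^\circ$ is the array $(r'_{u,v})$ with $r'_{u,v}=s_{n+1-u,n+1-v}$. *)

(* Defs.v *)
From HB Require Import structures.
From mathcomp Require Import all_boot all_order all_algebra all_fingroup.
From mathcomp Require Import all_solvable.

Set Implicit Arguments.
Unset Strict Implicit.
Unset Printing Implicit Defensive.

Import GRing.Theory.
Local Open Scope ring_scope.

(* An index in {1, ..., n} is an element of 'I_n = {0, ..., n-1}; [idx]
   recovers its 1-based value, the one that enters the formulas. *)
Definition idx (n : nat) (i : 'I_n) : nat := i.+1.

(* The entry s_{i,j} is [s i j]; entries are natural numbers because
   projections are obtained by integer summation. *)
Definition array (n : nat) := 'M[nat]_n.

Definition cube (n : nat) := 'I_n -> 'I_n -> 'I_n -> bool.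

Definition perm_array (n : nat) (s : array n) : Prop :=
  exists sigma : 'S_n, forall i j : 'I_n, s i j = (sigma j == i : nat).

Definition pos (n : nat) (P : 'I_n * 'I_n) : int * int :=
  ((idx P.1)%:Z, (idx P.2)%:Z).

Definition is_one (n : nat) (s : array n) (P : 'I_n * 'I_n) : Prop :=
  s P.1 P.2 = 1%N.

Definition costas_array (n : nat) (s : array n) : Prop :=
  perm_array s /\
  forall P Q P' Q' : 'I_n * 'I_n,
    is_one s P -> is_one s Q -> is_one s P' -> is_one s Q' ->
    P <> Q -> P' <> Q' -> (P, Q) <> (P', Q') ->
    pos Q - pos P <> pos Q' - pos P'.

Definition projA (n : nat) (d : cube n) : array n :=
  \matrix_(i, j) (\sum_(k < n) d i j k)%N.

Definition projB (n : nat) (d : cube n) : array n :=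
  \matrix_(i, k) (\sum_(j < n) d i j k)%N.

Definition projC (n : nat) (d : cube n) : array n :=
  \matrix_(j, k) (\sum_(i < n) d i j k)%N.

Definition costas_cube (n : nat) (d : cube n) : Prop :=
  [/\ costas_array (projA d), costas_array (projB d)
    & costas_array (projC d)].

(* [rev_ord] sends the 1-based index u to n + 1 - u; the first index is the
   horizontal coordinate. *)
Definition vreflect (n : nat) (s : array n) : array n :=
  \matrix_(u, v) s (rev_ord u) v.

Definition rotate180 (n : nat) (s : array n) : array n :=
  \matrix_(u, v) s (rev_ord u) (rev_ord v).

Definition primitive_elt (F : finFieldType) (x : F) : Prop :=
  exists2 u : {unit F}, val u = x & generator [set: {unit F}] u.

Definition G3 (F : finFieldType) (q : nat) (alpha : F) : array (q - 3) :=
  \matrix_(i, j)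
    (alpha ^+ (idx i).+1 + (1 - alpha) ^+ (idx j).+1 == 1 : nat).

(* The Golomb array is only defined when both alpha and 1 - alpha are
   primitive, so being the G_3(q, alpha) array includes these conditions. *)
Definition is_G3 (F : finFieldType) (q : nat) (alpha : F)
    (s : array (q - 3)) : Prop :=
  [/\ primitive_elt alpha, primitive_elt (1 - alpha) & s = G3 q alpha].

Arguments is_G3 {F} q alpha s.

Definition cubeD (F : finFieldType) (q : nat) (phi : F) : cube (q - 3) :=
  fun i j k =>
    [&& phi ^+ (idx i).+1 + (1 - phi) ^+ (idx j).+1 == 1,
        phi ^- (idx i).+1 + (1 - phi^-1) ^+ (idx k).+1 == 1
      & (1 - phi) ^- (idx j).+1 + (1 - phi^-1) ^- (idx k).+1 == 1].

Definition cubeE (F : finFieldType) (q : nat) (phi : F) : cube (q - 3) :=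
  fun i j k =>
    [&& phi ^+ (idx i).+1 + (1 - phi) ^+ (idx j).+1 == 1,
        phi ^+ idx i + (1 - phi^-1) ^+ (idx k).+1 == 1
      & (1 - phi) ^+ idx j + (1 - phi^-1) ^+ idx k == 1].

Arguments cubeD {F} q phi _ _ _.
Arguments cubeE {F} q phi _ _ _.

(* Main.v *)
Require Import Defs.
From mathcomp Require Import all_boot all_order all_algebra all_fingroup.
From mathcomp Require Import all_solvable.
From mathcomp Require Import zify ring.

Set Implicit Arguments.
Unset Strict Implicit.
Unset Printing Implicit Defensive.

Import GRing.Theory.
Local Open Scope ring_scope.

(** Write [psi = 1 - phi] and [chi = 1 - phi^-1].  Because
    [psi^-1 + chi^-1 = 1], also [1 - psi^-1 = chi^-1], so that (after a change
    of exponents for [E]) each of the three equations defining a cube is the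
    equation of a Golomb array: for [phi], [phi^-1] and [psi^-1].

    Consequently each equation is the relation of a permutation of the
    indices.  The three relations are moreover compatible: the first two
    imply the third.  For [D], with [x = phi^(i+1)], [y = psi^(j+1)] and
    [z = chi^(k+1)], the first two say [y = 1 - x] and [z = 1 - x^-1], and
    [y^-1 + z^-1 = 1] is the identity above with [x] for [phi].  For [E] they
    say [y = 1 - x] and [z = 1 - x / phi], and [y / psi + z / chi] is an affine
    function of [x] that is constantly [1].  Once three permutation relations
    form such a triangle, every pair of indices related by one of them extends
    in exactly one way to a triple related by all three
    ([triangle_projections]), so the projections of the cube are the three
    relations themselves.

    That a Golomb array is Costas is Viete's formula: two equal difference
    vectors give four field elements [x = alpha^(i+1)] with equal products
    of opposite pairs, and with equal products of the [1 - x], hence with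
    equal sums of opposite pairs; two pairs with the same sum and product
    coincide ([costas_G3]).  For [E] the arrays met are reflections of Golomb
    arrays, since [alpha^(q-1) = 1] turns [alpha^-(q-1-i)] into [alpha^i],
    and reflections preserve the Costas property ([costas_reindex]). *)

(** * Costas arrays *)

(** Equality of difference vectors, with the subtractions cleared: the form in
    which it can be fed to the exponents of a primitive element. *)
Lemma pos_subE n (P Q P' Q' : 'I_n * 'I_n) :
  pos Q - pos P = pos Q' - pos P' <->
  (Q.1 + P'.1 = Q'.1 + P.1)%N /\ (Q.2 + P'.2 = Q'.2 + P.2)%N.
Proof.
rewrite /pos /idx; split.
  by move=> E; case: E => E1 E2; split; lia.
by case=> E1 E2; congr (_, _) => /=; lia.
Qed.

(** Preserving coincidences between differences is all that the Costas
    property needs from a change of coordinates; both the identity and the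
    reversal of the indices do so. *)
Definition preserves_steps n (f : 'I_n -> 'I_n) :=
  injective f /\
  forall a b c d : 'I_n, (a + b = c + d)%N -> (f a + f b = f c + f d)%N.

Lemma preserves_steps_id n : preserves_steps (@id 'I_n).
Proof. by split. Qed.

Lemma preserves_steps_rev n : preserves_steps (@rev_ord n).
Proof.
split=> [|a b c d /= E]; first exact: rev_ord_inj.
have := ltn_ord a; have := ltn_ord b; have := ltn_ord c; have := ltn_ord d.
lia.
Qed.

Lemma costas_reindex n (s : array n) (f g : 'I_n -> 'I_n) :
  preserves_steps f -> preserves_steps g ->
  costas_array s -> costas_array (\matrix_(u, v) s (f u) (g v)).
Proof.
move=> [f_inj f_steps] [g_inj g_steps] [[sigma sE] s_costas]; split.
  exists (perm g_inj * sigma * (perm f_inj)^-1)%g => i j.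
  by rewrite mxE sE -[in RHS](inj_eq (@perm_inj _ (perm f_inj))) !permM permKV !permE.
pose fg (P : 'I_n * 'I_n) := (f P.1, g P.2).
have fg_inj : injective fg.
  by move=> [a b] [c d] [/f_inj-> /g_inj->].
move=> P Q P' Q'; rewrite /is_one !mxE => sP sQ sP' sQ' PQ PQ' PQPQ'.
case/pos_subE=> E1 E2.
apply: (s_costas (fg P) (fg Q) (fg P') (fg Q')) => //.
- by move/fg_inj.
- by move/fg_inj.
- by move=> E; apply: PQPQ'; case: (congr1 fst E, congr1 snd E) => /fg_inj-> /fg_inj->.
by apply/pos_subE; split; [apply: f_steps | apply: g_steps].
Qed.

Lemma costas_vreflect n (s : array n) :
  costas_array s -> costas_array (vreflect s).
Proof.
exact: costas_reindex (@preserves_steps_rev n) (@preserves_steps_id n).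
Qed.

Lemma costas_rotate180 n (s : array n) :
  costas_array s -> costas_array (rotate180 s).
Proof.
exact: costas_reindex (@preserves_steps_rev n) (@preserves_steps_rev n).
Qed.

(** * Projections of a cube cut out by three permutation relations *)

Definition rel_array n (P : 'I_n -> 'I_n -> bool) : array n :=
  \matrix_(i, j) (P i j : nat).

Lemma perm_rel_array n (P : 'I_n -> 'I_n -> bool) :
  perm_array (rel_array P) ->
  exists sigma : 'S_n, forall i j, P i j = (sigma j == i).
Proof.
case=> sigma sE; exists sigma => i j.
by have := sE i j; rewrite mxE; case: (P i j); case: eqP.
Qed.

Lemma sum_indicator n (P : 'I_n -> bool) (i0 : 'I_n) (b : bool) :
  (forall i, P i = (i == i0) && b) -> (\sum_(i < n) P i)%N = b.
Proof.
move=> PE; rewrite (bigD1 i0) //= PE eqxx big1 ?addn0 // => i /negbTE i_i0.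
by rewrite PE i_i0.
Qed.

(** One implication suffices: the other two ways of deducing a relation from
    the remaining pair follow because the relations are permutations. *)
Lemma triangle_projections n (P Q R : 'I_n -> 'I_n -> bool) :
  perm_array (rel_array P) -> perm_array (rel_array Q) ->
  perm_array (rel_array R) ->
  (forall i j k, P i j -> Q i k -> R j k) ->
  let d : Defs.cube n := fun i j k => [&& P i j, Q i k & R j k] in
  [/\ projA d = rel_array P, projB d = rel_array Q & projC d = rel_array R].
Proof.
move=> /perm_rel_array[s PE] /perm_rel_array[t QE] /perm_rel_array[r RE] PQR d.
(* The implication says that the permutation of Q is that of P after that
   of R. *)
have trE k : t k = s (r k).
  have -> : r k = (s^-1)%g (t k); last by rewrite permKV.
  apply/eqP; rewrite -RE; apply: (PQR (t k)); last by rewrite QE.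
  by rewrite PE permKV.
split; apply/matrixP=> a b; rewrite !mxE.
- apply: (@sum_indicator _ _ ((r^-1)%g b)) => k.
  rewrite /d PE QE RE trE (can2_eq (permK r) (permKV r)).
  by case: (k =P _) => [->|_]; rewrite ?permKV ?andbF ?andbT ?andbb.
- apply: (@sum_indicator _ _ (r b)) => j.
  rewrite /d PE QE RE trE [j == _]eq_sym.
  by case: (r b =P j) => [<-|_]; rewrite ?andbF ?andbT ?andbb.
apply: (@sum_indicator _ _ (s a)) => i.
rewrite /d PE QE RE trE [i == _]eq_sym.
by case: (r b =P a) => [->|_]; rewrite ?andbF ?andbT ?andbb.
Qed.

(** * Powers of a primitive element *)

Section Primitive.

Variable F : finFieldType.
Implicit Types (x y : F).

Lemma primitive_neq0 x : primitive_elt x -> x != 0.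
Proof. by case=> u <- _; rewrite -unitfE (valP u). Qed.

Lemma primitive_inv x : primitive_elt x -> primitive_elt x^-1.
Proof.
case=> u <- u_gen; exists (u^-1)%g; first by rewrite FinRing.val_unitV.
by rewrite /generator cycleV.
Qed.

Lemma primitive_expr_card x : primitive_elt x -> x ^+ #|F|.-1 = 1.
Proof.
case=> u <- /eqP u_gen.
by rewrite -card_finField_unit u_gen -FinRing.val_unitX expg_order.
Qed.

Lemma primitive_expr_inj x m n : primitive_elt x ->
  (m < #|F|.-1)%N -> (n < #|F|.-1)%N -> x ^+ m = x ^+ n -> m = n.
Proof.
case=> u <- /eqP u_gen; rewrite -card_finField_unit u_gen => lt_m lt_n.
rewrite -!FinRing.val_unitX => /val_inj/eqP.
by rewrite eq_expg_mod_order !modn_small // => /eqP.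
Qed.

Lemma primitive_exprP x y : primitive_elt x -> y != 0 ->
  exists2 m, (m < #|F|.-1)%N & x ^+ m = y.
Proof.
case=> u <- /eqP u_gen; rewrite -unitfE => y_unit.
have : FinRing.unit F y_unit \in <[u]>%g by rewrite -u_gen inE.
case/cyclePmin=> m lt_m /(congr1 val) /= yE; exists m.
  by rewrite -card_finField_unit u_gen.
by rewrite yE FinRing.val_unitX.
Qed.

(** A Golomb array uses the exponents [2, ..., q-2] out of the full period
    [0, ..., q-2], so that the powers lost are [x^0 = 1] and [x^1 = x]. *)
Lemma golomb_powerP x y : primitive_elt x ->
  reflect (exists i : 'I_(#|F| - 3), x ^+ i.+2 = y)
          [&& y != 0, y != 1 & y != x].
Proof.
move=> x_prim; apply: (iffP and3P).
  case=> y0 y1 yx; have [[|[|m]] lt_m yE] := primitive_exprP x_prim y0.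
  - by rewrite -yE expr0 eqxx in y1.
  - by rewrite -yE expr1 eqxx in yx.
  have lt_m3 : (m < #|F| - 3)%N by lia.
  by exists (Ordinal lt_m3).
case=> i <-; have lt_i := ltn_ord i; split.
- by rewrite expf_neq0 // primitive_neq0.
- apply/eqP; rewrite -(expr0 x) => /(primitive_expr_inj x_prim) E.
  by suff: i.+2 = 0%N by []; apply: E; lia.
apply/eqP; rewrite -[RHS]expr1 => /(primitive_expr_inj x_prim) E.
by suff: i.+2 = 1%N by []; apply: E; lia.
Qed.

Lemma golomb_power_inj x : primitive_elt x ->
  injective (fun i : 'I_(#|F| - 3) => x ^+ i.+2).
Proof.
move=> x_prim i j /(primitive_expr_inj x_prim) E; apply: val_inj => /=.
have lt_i := ltn_ord i; have lt_j := ltn_ord j.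
by apply/succn_inj/succn_inj/E; lia.
Qed.

(** Reversing the exponents amounts to inverting the primitive element; this
    is how reflected Golomb arrays arise. *)
Lemma primitive_expr_sub x m : primitive_elt x -> (m <= #|F|.-1)%N ->
  x^-1 ^+ (#|F|.-1 - m) = x ^+ m.
Proof.
move=> x_prim le_m; have x0 := primitive_neq0 x_prim.
rewrite exprVn; apply: (mulfI (expf_neq0 (#|F|.-1 - m) x0)).
by rewrite mulfV ?expf_neq0 // -exprD subnK // primitive_expr_card.
Qed.

(** * Golomb arrays *)

(** Since [(1 - a) * (1 - b) = 1 - (a + b) + a * b], the sums are equal too, and
    both pairs are the roots of the same quadratic polynomial. *)
Lemma complement_products (a b c d : F) :
  a * b = c * d -> (1 - a) * (1 - b) = (1 - c) * (1 - d) ->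
  (a = c /\ b = d) \/ (a = d /\ b = c).
Proof.
move=> E1 E2; have E3 : a + b = c + d.
  have -> : a + b = 1 + a * b - (1 - a) * (1 - b) by ring.
  by rewrite E1 E2; ring.
have /eqP : (a - c) * (a - d) = 0.
  have -> : (a - c) * (a - d) = a * (a + b) - a * b - a * (c + d) + c * d
    by ring.
  by rewrite E1 E3; ring.
rewrite mulf_eq0 !subr_eq0 => /orP[] /eqP aE; [left | right]; split=> //.
  by move: E3; rewrite aE => /addrI.
by move: E3; rewrite aE [d + b]addrC => /addIr.
Qed.

Variable x : F.
Hypothesis x_prim : primitive_elt x.
Hypothesis x1_prim : primitive_elt (1 - x).

Let G := G3 #|F| x.

Lemma G3_oneP (P : 'I_(#|F| - 3) * 'I_(#|F| - 3)) :
  is_one G P <-> (1 - x) ^+ P.2.+2 = 1 - x ^+ P.1.+2.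
Proof.
rewrite /is_one mxE /idx; split.
  by case: eqP => // /(canRL (addKr _))-> _; rewrite addrC.
by move->; rewrite addrC subrK eqxx.
Qed.

(** The reflection [t -> 1 - t] of the field exchanges [0] with [1] and [1 - x]
    with [x], hence maps the values of one family of powers onto those of the
    other. *)
Lemma perm_G3 : perm_array G.
Proof.
have ex_i (j : 'I_(#|F| - 3)) :
    exists i : 'I_(#|F| - 3), x ^+ i.+2 == 1 - (1 - x) ^+ j.+2.
  have /(golomb_powerP _ x1_prim)/and3P[y0 y1 yx] :
    exists j' : 'I_(#|F| - 3), (1 - x) ^+ j'.+2 = (1 - x) ^+ j.+2 by exists j.
  have /(golomb_powerP _ x_prim)[i xE] : [&& 1 - (1 - x) ^+ j.+2 != 0,
      1 - (1 - x) ^+ j.+2 != 1 & 1 - (1 - x) ^+ j.+2 != x].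
    apply/and3P; split.
    - by rewrite subr_eq0 eq_sym.
    - by rewrite -subr_eq0 addrAC subrr sub0r oppr_eq0.
    by rewrite subr_eq addrC -subr_eq eq_sym.
  by exists i; rewrite xE.
pose f j := xchoose (ex_i j).
have fE j : x ^+ (f j).+2 = 1 - (1 - x) ^+ j.+2 := eqP (xchooseP (ex_i j)).
have f_inj : injective f.
  move=> j j' /(congr1 (fun i : 'I_(#|F| - 3) => x ^+ i.+2)).
  by rewrite !fE => /addrI/oppr_inj/(golomb_power_inj x1_prim).
exists (perm f_inj) => i j; rewrite mxE permE /idx; congr nat_of_bool.
by rewrite eq_sym -subr_eq -fE (inj_eq (golomb_power_inj x_prim)).
Qed.

Lemma costas_G3 : costas_array G.
Proof.
split=> [|P Q P' Q']; first exact: perm_G3.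
move=> /G3_oneP yP /G3_oneP yQ /G3_oneP yP' /G3_oneP yQ' PQ PQ' PQPQ'.
case/pos_subE=> E1 E2.
have G3_inj (A B : 'I_(#|F| - 3) * 'I_(#|F| - 3)) :
    (1 - x) ^+ A.2.+2 = 1 - x ^+ A.1.+2 ->
    (1 - x) ^+ B.2.+2 = 1 - x ^+ B.1.+2 ->
    x ^+ A.1.+2 = x ^+ B.1.+2 -> A = B.
  case: A B => [a1 a2] [b1 b2] /= yA yB xAB.
  rewrite (golomb_power_inj x_prim xAB); congr (_, _).
  by apply: (golomb_power_inj x1_prim); rewrite yA yB xAB.
have X : x ^+ Q.1.+2 * x ^+ P'.1.+2 = x ^+ Q'.1.+2 * x ^+ P.1.+2.
  by rewrite -!exprD; congr (_ ^+ _); lia.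
have Y : (1 - x ^+ Q.1.+2) * (1 - x ^+ P'.1.+2) =
         (1 - x ^+ Q'.1.+2) * (1 - x ^+ P.1.+2).
  by rewrite -yQ -yP' -yQ' -yP -!exprD; congr (_ ^+ _); lia.
case: (complement_products X Y) => -[xE xE'].
  by apply: PQPQ'; rewrite (G3_inj _ _ yQ yQ') // (G3_inj _ _ yP' yP).
by apply: PQ; rewrite (G3_inj _ _ yQ yP).
Qed.

End Primitive.

(** * The two cubes *)

Section Cubes.

Variables (F : finFieldType) (phi : F).
Hypothesis phi_prim : primitive_elt phi.
Hypothesis psi_prim : primitive_elt (1 - phi).
Hypothesis chi_prim : primitive_elt (1 - phi^-1).

Let phi0 : phi != 0 := primitive_neq0 phi_prim.
Let psi0 : 1 - phi != 0 := primitive_neq0 psi_prim.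
Let chi0 : 1 - phi^-1 != 0 := primitive_neq0 chi_prim.

(** The relation that makes the third equation of a cube a Golomb one. *)
Lemma chi_inv : 1 - (1 - phi)^-1 = (1 - phi^-1)^-1.
Proof.
apply: (mulIf chi0); rewrite mulVf //; field.
by rewrite phi0 psi0.
Qed.

Let psiV_prim : primitive_elt (1 - (1 - phi)^-1).
Proof. by rewrite chi_inv; apply: primitive_inv. Qed.

Lemma is_G3_phi : is_G3 #|F| phi (G3 #|F| phi).
Proof. by split. Qed.

Lemma is_G3_phiV : is_G3 #|F| phi^-1 (G3 #|F| phi^-1).
Proof. by split=> //; apply: primitive_inv. Qed.

Lemma is_G3_psiV : is_G3 #|F| (1 - phi)^-1 (G3 #|F| (1 - phi)^-1).
Proof. by split=> //; apply: primitive_inv. Qed.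

Lemma is_G3_costas (alpha : F) s : is_G3 #|F| alpha s -> costas_array s.
Proof. by case=> alpha_prim alpha1_prim ->; apply: costas_G3. Qed.

Lemma cubeD_projections :
  [/\ projA (cubeD #|F| phi) = G3 #|F| phi,
      projB (cubeD #|F| phi) = G3 #|F| phi^-1
    & projC (cubeD #|F| phi) = G3 #|F| (1 - phi)^-1].
Proof.
pose P (i j : 'I_(#|F| - 3)) :=
  phi ^+ (idx i).+1 + (1 - phi) ^+ (idx j).+1 == 1.
pose Q (i k : 'I_(#|F| - 3)) :=
  phi ^- (idx i).+1 + (1 - phi^-1) ^+ (idx k).+1 == 1.
pose R (j k : 'I_(#|F| - 3)) :=
  (1 - phi) ^- (idx j).+1 + (1 - phi^-1) ^- (idx k).+1 == 1.
have PE : rel_array P = G3 #|F| phi by [].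
have QE : rel_array Q = G3 #|F| phi^-1.
  by apply/matrixP=> i k; rewrite !mxE /Q exprVn.
have RE : rel_array R = G3 #|F| (1 - phi)^-1.
  by apply/matrixP=> j k; rewrite !mxE /R chi_inv !exprVn.
rewrite -PE -QE -RE; apply: triangle_projections.
- by rewrite PE; case: (is_G3_costas is_G3_phi).
- by rewrite QE; case: (is_G3_costas is_G3_phiV).
- by rewrite RE; case: (is_G3_costas is_G3_psiV).
move=> i j k; rewrite /P /Q /R /idx.
have := expf_neq0 i.+2 phi0; have := expf_neq0 j.+2 psi0.
have := expf_neq0 k.+2 chi0.
move: (phi ^+ _) ((1 - phi) ^+ _) ((1 - phi^-1) ^+ _) => x y z z0 y0 x0.
move=> /eqP/(canRL (addKr _)) yE /eqP/(canRL (addKr _)) zE.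
have zx : z = - (y / x) by rewrite zE yE; field.
apply/eqP; rewrite zx invrN invf_div.
have -> : x = 1 - y by rewrite yE; ring.
by field.
Qed.

Lemma cubeE_projections :
  [/\ projA (cubeE #|F| phi) = G3 #|F| phi,
      projB (cubeE #|F| phi) = vreflect (G3 #|F| phi^-1)
    & projC (cubeE #|F| phi) = rotate180 (G3 #|F| (1 - phi)^-1)].
Proof.
pose P (i j : 'I_(#|F| - 3)) :=
  phi ^+ (idx i).+1 + (1 - phi) ^+ (idx j).+1 == 1.
pose Q (i k : 'I_(#|F| - 3)) :=
  phi ^+ idx i + (1 - phi^-1) ^+ (idx k).+1 == 1.
pose R (j k : 'I_(#|F| - 3)) :=
  (1 - phi) ^+ idx j + (1 - phi^-1) ^+ idx k == 1.
have PE : rel_array P = G3 #|F| phi by [].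
have rev_expr (x : F) (i : 'I_(#|F| - 3)) : primitive_elt x ->
    x^-1 ^+ (idx (rev_ord i)).+1 = x ^+ idx i.
  move=> x_prim; have lt_i := ltn_ord i; rewrite /idx.
  rewrite -(@primitive_expr_sub _ _ i.+1 x_prim); last by lia.
  have revE : nat_of_ord (rev_ord i) = (#|F| - 3 - i.+1)%N by [].
  by congr (_ ^+ _); rewrite revE; lia.
have QE : rel_array Q = vreflect (G3 #|F| phi^-1).
  by apply/matrixP=> i k; rewrite !mxE /Q rev_expr.
have RE : rel_array R = rotate180 (G3 #|F| (1 - phi)^-1).
  by apply/matrixP=> j k; rewrite !mxE /R chi_inv !rev_expr.
rewrite -PE -QE -RE; apply: triangle_projections.
- by rewrite PE; case: (is_G3_costas is_G3_phi).
- by rewrite QE; case: (costas_vreflect (is_G3_costas is_G3_phiV)).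
- by rewrite RE; case: (costas_rotate180 (is_G3_costas is_G3_psiV)).
move=> i j k; rewrite /P /Q /R /idx [phi ^+ i.+2]exprS.
rewrite ![_ ^+ j.+2]exprS ![_ ^+ k.+2]exprS.
move: (phi ^+ _) ((1 - phi) ^+ _) ((1 - phi^-1) ^+ _) => x y z.
move=> /eqP/(canRL (addKr _)) yE /eqP/(canRL (addKr _)) zE.
have -> : y = (1 - phi * x) / (1 - phi).
  by rewrite [1 - phi * x]addrC -yE mulrC mulKf.
have -> : z = (1 - x) / (1 - phi^-1).
  by rewrite [1 - x]addrC -zE mulrC mulKf.
apply/eqP; rewrite -chi_inv; field.
by rewrite psi0.
Qed.

End Cubes.

Theorem theorem11 (q : nat) (F : finFieldType) (phi : F)
    (hF : #|F| = q) (hq : (3 < q)%N)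
    (hphi : primitive_elt phi) (hphi1 : primitive_elt (1 - phi))
    (hphi2 : primitive_elt (1 - phi^-1)) :
  (costas_cube (cubeD q phi) /\
   is_G3 q phi (projA (cubeD q phi)) /\
   is_G3 q phi^-1 (projB (cubeD q phi)) /\
   is_G3 q (1 - phi)^-1 (projC (cubeD q phi)))
  /\
  (costas_cube (cubeE q phi) /\
   is_G3 q phi (projA (cubeE q phi)) /\
   (exists2 s : array (q - 3),
      is_G3 q phi^-1 s & projB (cubeE q phi) = vreflect s) /\
   (exists2 s : array (q - 3),
      is_G3 q (1 - phi)^-1 s & projC (cubeE q phi) = rotate180 s)).
Proof.
move: hq; subst q => _.
have gA := is_G3_phi hphi hphi1.
have gB := is_G3_phiV hphi hphi2.
have gC := is_G3_psiV hphi hphi1 hphi2.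
have [cA cB cC] := And3 (is_G3_costas gA) (is_G3_costas gB) (is_G3_costas gC).
rewrite /costas_cube; split.
  by have [-> -> ->] := cubeD_projections hphi hphi1 hphi2.
have [-> -> ->] := cubeE_projections hphi hphi1 hphi2.
split; first by split=> //; [apply: costas_vreflect | apply: costas_rotate180].
by split=> //; split; [exists (G3 #|F| phi^-1) | exists (G3 #|F| (1 - phi)^-1)].
Qed.
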